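(* Let $r,s\ge0$ be integers with $r+s\ge1$. If $r=0$ or $s=0$, then the pseudo $H$-type Lie algebra $\mathfrak n_{r,s}=\mathfrak v_{r,s}\oplus\mathfrak z_{r,s}$ has the strongly bracket generating property: for every non-zero $v\in\mathfrak v_{r,s}$ the linear map $\mathrm{ad}_v=[v,\cdot\,]:\mathfrak v_{r,s}\to\mathfrak z_{r,s}$ is surjective.
   Context: For integers $r,s\ge 0$ with $r+s\ge1$, $\mathbb R^{r,s}$ is $\mathbb R^{r+s}$ with $\langle Z,W\rangle_{r,s}=\sum_{i=1}^r Z_iW_i-\sum_{j=r+1}^{r+s}Z_jW_j$, and $\mathrm{Cl}_{r,s}$ is the real unital associative algebra generated by $\mathbb R^{r,s}$ subject to $Z\otimes Z=-\langle Z,Z\rangle_{r,s}\,1$. A scalar product is a non-degenerate (possibly indefinite) symmetric bilinear form. An admissible $\mathrm{Cl}_{r,s}$-module is a non-zero finite-dimensional real vector space $\mathfrak v$ with a representation $J:\mathrm{Cl}_{r,s}\to\mathrm{End}(\mathfrak v)$ and a scalar product $\langle\cdot,\cdot\rangle_{\mathfrak v}$ such that $\langle J_Zv,w\rangle_{\mathfrak v}=-\langle v,J_Zw\rangle_{\mathfrak v}$ for all $Z\in\mathbb R^{r,s}$, $v,w\in\mathfrak v$. It is minimal if its dimension is minimal among admissible $\mathrm{Cl}_{r,s}$-modules. The associated pseudo $H$-type Lie algebra is $\mathfrak n=\mathfrak v\oplus\mathbb R^{r,s}$ (orthogonal sum), with center $\mathbb R^{r,s}$ and bracket $[\cdot,\cdot]:\mathfrak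 v\times\mathfrak v\to\mathbb R^{r,s}$ determined by $\langle J_Zv,w\rangle_{\mathfrak v}=\langle Z,[v,w]\rangle_{r,s}$ for all $Z\in\mathbb R^{r,s}$, $v,w\in\mathfrak v$. The notation $\mathfrak n_{r,s}=\mathfrak v_{r,s}\oplus\mathfrak z_{r,s}$, $\mathfrak z_{r,s}=\mathbb R^{r,s}$, stands for the pseudo $H$-type Lie algebra built from a minimal admissible module $\mathfrak v_{r,s}$ (for $s=0$ the scalar product on $\mathfrak v_{r,0}$ is positive definite). *)

(* Defs.v *)
From HB Require Import structures.
From mathcomp Require Import all_boot all_order all_algebra.
From mathcomp Require Import boolp reals.
Set Implicit Arguments.
Unset Strict Implicit.
Unset Printing Implicit Defensive.
Import Order.TTheory GRing.Theory Num.Theory.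
Local Open Scope ring_scope.
Local Open Scope quotient_scope.

Definition pform (R : realType) (r s : nat) (Z W : 'rV[R]_(r + s)) : R :=
  \sum_(i < r) Z 0 (lshift s i) * W 0 (lshift s i)
  - \sum_(j < s) Z 0 (rshift r j) * W 0 (rshift r j).

Section PForm.
Variables (R : realType) (r s : nat).
Local Notation V := 'rV[R]_(r + s).

Lemma pform_sym (Z W : V) : pform Z W = pform W Z.
Proof. by rewrite /pform; congr (_ - _); apply: eq_bigr => i _; rewrite mulrC. Qed.

Lemma pformDr (Z W1 W2 : V) : pform Z (W1 + W2) = pform Z W1 + pform Z W2.
Proof.
rewrite /pform addrACA -opprD -!big_split /=.
by congr (_ - _); apply: eq_bigr => i _; rewrite mxE mulrDr.
Qed.

Lemma pformZr a (Z W : V) : pform Z (a *: W) = a * pform Z W.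
Proof.
rewrite /pform mulrBr !mulr_sumr.
by congr (_ - _); apply: eq_bigr => i _; rewrite mxE mulrCA.
Qed.

Lemma pform0r (Z : V) : pform Z 0 = 0.
Proof. by rewrite -(scale0r 0) pformZr mul0r. Qed.

Definition psgn (i : 'I_(r + s)) : R := if split i is inl _ then 1 else -1.

Lemma psgn_sqr i : psgn i * psgn i = 1.
Proof. by rewrite /psgn; case: split => _; rewrite ?mulrNN mulr1. Qed.

Lemma pformE (Z W : V) : pform Z W = \sum_i psgn i * (Z 0 i * W 0 i).
Proof.
rewrite big_split_ord /= /pform -sumrN; congr (_ + _); apply: eq_bigr => i _.
  by rewrite /psgn -[lshift s i]/(unsplit (inl i)) unsplitK mul1r.
by rewrite /psgn -[rshift r i]/(unsplit (inr i)) unsplitK mulN1r.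
Qed.

Lemma pform_delta i (W : V) : pform (delta_mx 0 i) W = psgn i * W 0 i.
Proof.
rewrite pformE (bigD1 i) //= mxE !eqxx mul1r big1 ?addr0 // => j ji.
by rewrite mxE (negPf ji) andbF mul0r mulr0.
Qed.

Lemma pform_nondeg (W W' : V) :
  (forall Z, pform Z W = pform Z W') -> W = W'.
Proof.
move=> h; apply/rowP => i; have := h (delta_mx 0 i); rewrite !pform_delta.
by move/(congr1 ( *%R (psgn i))); rewrite !mulrA psgn_sqr !mul1r.
Qed.

End PForm.

(* Cl_{r,s} is the quotient of the formal unital algebra expressions in the vectors of
  R^{r,s} by the least congruence containing the axioms of associative unital
  algebras, the linearity of R^{r,s} -> Cl_{r,s}, and the Clifford relation. *)

Inductive cl_term (R : realType) (r s : nat) : Type :=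
| CVec of 'rV[R]_(r + s)
| CZero
| COne
| COpp of cl_term R r s
| CAdd of cl_term R r s & cl_term R r s
| CMul of cl_term R r s & cl_term R r s
| CScale of R & cl_term R r s.
Arguments CZero {R r s}.
Arguments COne {R r s}.

Inductive cl_eq (R : realType) (r s : nat) :
    cl_term R r s -> cl_term R r s -> Prop :=
| cl_refl x : cl_eq x x
| cl_sym x y : cl_eq x y -> cl_eq y x
| cl_trans x y z : cl_eq x y -> cl_eq y z -> cl_eq x z
| cl_congN x x' : cl_eq x x' -> cl_eq (COpp x) (COpp x')
| cl_congD x x' y y' : cl_eq x x' -> cl_eq y y' ->
    cl_eq (CAdd x y) (CAdd x' y')
| cl_congM x x' y y' : cl_eq x x' -> cl_eq y y' ->
    cl_eq (CMul x y) (CMul x' y')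
| cl_congZ a x x' : cl_eq x x' -> cl_eq (CScale a x) (CScale a x')
| cl_addA x y z : cl_eq (CAdd x (CAdd y z)) (CAdd (CAdd x y) z)
| cl_addC x y : cl_eq (CAdd x y) (CAdd y x)
| cl_add0 x : cl_eq (CAdd CZero x) x
| cl_addN x : cl_eq (CAdd (COpp x) x) CZero
| cl_scaleA a b x : cl_eq (CScale a (CScale b x)) (CScale (a * b) x)
| cl_scale1 x : cl_eq (CScale 1 x) x
| cl_scaleDr a x y :
    cl_eq (CScale a (CAdd x y)) (CAdd (CScale a x) (CScale a y))
| cl_scaleDl a b x :
    cl_eq (CScale (a + b) x) (CAdd (CScale a x) (CScale b x))
| cl_mulA x y z : cl_eq (CMul x (CMul y z)) (CMul (CMul x y) z)
| cl_mul1L x : cl_eq (CMul COne x) x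
| cl_mul1R x : cl_eq (CMul x COne) x
| cl_mulDl x y z : cl_eq (CMul (CAdd x y) z) (CAdd (CMul x z) (CMul y z))
| cl_mulDr x y z : cl_eq (CMul x (CAdd y z)) (CAdd (CMul x y) (CMul x z))
| cl_scaleAl a x y : cl_eq (CScale a (CMul x y)) (CMul (CScale a x) y)
| cl_scaleAr a x y : cl_eq (CScale a (CMul x y)) (CMul x (CScale a y))
| cl_vec_linear a Z W :
    cl_eq (CVec (a *: Z + W)) (CAdd (CScale a (CVec Z)) (CVec W))
| cl_clifford Z :
    cl_eq (CMul (CVec Z) (CVec Z)) (CScale (- pform Z Z) COne).

Section Eval.
Variables (R : realType) (r s : nat) (A : algType R).
Variable f : {linear 'rV[R]_(r + s) -> A}.
Hypothesis f_clifford : forall Z, f Z * f Z = (- pform Z Z)%:A.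

Fixpoint cl_eval (t : cl_term R r s) : A :=
  match t with
  | CVec Z => f Z
  | CZero => 0
  | COne => 1
  | COpp x => - cl_eval x
  | CAdd x y => cl_eval x + cl_eval y
  | CMul x y => cl_eval x * cl_eval y
  | CScale a x => a *: cl_eval x
  end.

Lemma cl_eval_eq t u : cl_eq t u -> cl_eval t = cl_eval u.
Proof.
elim=> //=.
- by move=> x y z _ -> _ ->.
- by move=> x x' _ ->.
- by move=> x x' y y' _ -> _ ->.
- by move=> x x' y y' _ -> _ ->.
- by move=> a x x' _ ->.
- by move=> x y z; rewrite addrA.
- by move=> x y; rewrite addrC.
- by move=> x; rewrite add0r.
- by move=> x; rewrite addNr.
- by move=> a b x; rewrite scalerA.
- by move=> x; rewrite scale1r.
- by move=> a x y; rewrite scalerDr.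
- by move=> a b x; rewrite scalerDl.
- by move=> x y z; rewrite mulrA.
- by move=> x; rewrite mul1r.
- by move=> x; rewrite mulr1.
- by move=> x y z; rewrite mulrDl.
- by move=> x y z; rewrite mulrDr.
- by move=> a x y; rewrite scalerAl.
- by move=> a x y; rewrite scalerAr.
- by move=> a Z W; rewrite linearP.
Qed.

End Eval.

(* A matrix model, used only to show that Cl_{r,s} is not the zero ring. *)
Lemma clifford_model (R : realType) n (q : 'I_n -> R) :
  exists k (f : {linear 'rV[R]_n -> 'M[R]_k.+1}),
    forall Z, f Z * f Z = (\sum_i q i * (Z 0 i * Z 0 i))%:A.
Proof.
elim: n q => [|n IHn] q.
  have lin : linear (fun _ : 'rV[R]_0 => 0 : 'M[R]_1).
    by move=> a u v; rewrite scaler0 addr0.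
  pose f : {linear _ -> _} := HB.pack (fun _ : 'rV[R]_0 => 0 : 'M[R]_1)
    (GRing.isLinear.Build _ _ _ _ _ lin).
  by exists 0%N, f => Z; rewrite big_ord0 scale0r /= mulr0.
have [k [f fP]] := IHn (fun i => q (lift ord0 i)).
pose tl (Z : 'rV[R]_n.+1) : 'rV[R]_n := \row_i Z 0 (lift ord0 i).
have tlP a u v : tl (a *: u + v) = a *: tl u + tl v.
  by apply/rowP => i; rewrite !mxE.
pose g (Z : 'rV[R]_n.+1) : 'M[R]_(k.+1 + k.+1) :=
  block_mx (f (tl Z)) (q ord0 * Z 0 ord0)%:M (Z 0 ord0)%:M (- f (tl Z)).
have lin : linear g.
  move=> a u v; rewrite /g scale_block_mx add_block_mx tlP linearP !mxE.
  congr (block_mx _ _ _ _).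
  - by rewrite scale_scalar_mx mulrDr mulrCA; apply: raddfD.
  - by rewrite scale_scalar_mx; apply: raddfD.
  - by rewrite opprD scalerN.
have gP Z : g Z *m g Z = (\sum_i q i * (Z 0 i * Z 0 i))%:M.
  have fE : f (tl Z) *m f (tl Z)
      = (\sum_i q (lift ord0 i) * (Z 0 (lift ord0 i) * Z 0 (lift ord0 i)))%:M.
    have := fP (tl Z); rewrite -[_ * _]/(_ *m _) => ->.
    by rewrite scalemx1; congr (_%:M); apply: eq_bigr => i _; rewrite mxE.
  rewrite /g mulmx_block !mulNmx !mulmxN opprK fE -!scalar_mxM.
  rewrite !mul_mx_scalar !mul_scalar_mx !subrr -!raddfD /=.
  rewrite scalar_mx_block big_ord_recl.
  congr (block_mx _%:M _ _ _%:M).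
    by rewrite mulrA addrC.
  by rewrite mulrCA.
pose g' : {linear _ -> _} := HB.pack (g : _ -> 'M[R]_((k + k.+1).+1))
  (GRing.isLinear.Build _ _ _ _ _ lin).
by exists (k + k.+1)%N, g' => Z; rewrite -[LHS]/(g Z *m g Z) gP -scalemx1.
Qed.

Section Clifford.
Variables (R : realType) (r s : nat).
Local Notation T := (cl_term R r s).

HB.instance Definition _ := gen_eqMixin T.
HB.instance Definition _ := gen_choiceMixin T.

Definition cl_eqb (x y : T) : bool := `[< cl_eq x y >].

Lemma cl_eqb_refl : reflexive cl_eqb.
Proof. by move=> x; apply/asboolP; apply: cl_refl. Qed.
Lemma cl_eqb_sym : symmetric cl_eqb.
Proof. by move=> x y; apply/asboolP/asboolP => /cl_sym. Qed.
Lemma cl_eqb_trans : transitive cl_eqb.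
Proof.
by move=> y x z /asboolP xy /asboolP yz; apply/asboolP; apply: cl_trans xy yz.
Qed.

Canonical cl_equiv := EquivRel cl_eqb cl_eqb_refl cl_eqb_sym cl_eqb_trans.

Definition clifford := {eq_quot cl_equiv}.
HB.instance Definition _ := Choice.on clifford.
HB.instance Definition _ := EqQuotient.on clifford.

Definition cl_of (t : T) : clifford := \pi_clifford t.

Lemma cl_ofP (t u : T) : cl_of t = cl_of u <-> cl_eq t u.
Proof.
by split=> [/eqquotP/asboolP //|tu]; apply/eqquotP/asboolP.
Qed.

Lemma cl_of_repr (x : clifford) : cl_of (repr x) = x.
Proof. exact: reprK. Qed.

Lemma cl_repr_of (t : T) : cl_eq (repr (cl_of t)) t.
Proof. by apply/cl_ofP; rewrite cl_of_repr. Qed.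

Definition cl_zero : clifford := cl_of CZero.
Definition cl_one : clifford := cl_of COne.
Definition cl_opp (x : clifford) : clifford := cl_of (COpp (repr x)).
Definition cl_add (x y : clifford) : clifford := cl_of (CAdd (repr x) (repr y)).
Definition cl_mul (x y : clifford) : clifford := cl_of (CMul (repr x) (repr y)).
Definition cl_scale a (x : clifford) : clifford := cl_of (CScale a (repr x)).

Lemma cl_oppE t : cl_opp (cl_of t) = cl_of (COpp t).
Proof. by apply/cl_ofP/cl_congN/cl_repr_of. Qed.
Lemma cl_addE t u : cl_add (cl_of t) (cl_of u) = cl_of (CAdd t u).
Proof. by apply/cl_ofP/cl_congD; apply/cl_repr_of. Qed.
Lemma cl_mulE t u : cl_mul (cl_of t) (cl_of u) = cl_of (CMul t u).
Proof. by apply/cl_ofP/cl_congM; apply/cl_repr_of. Qed.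
Lemma cl_scaleE a t : cl_scale a (cl_of t) = cl_of (CScale a t).
Proof. by apply/cl_ofP/cl_congZ/cl_repr_of. Qed.

Let clE := (cl_oppE, cl_addE, cl_mulE, cl_scaleE).

Lemma cl_ind (P : clifford -> Prop) : (forall t, P (cl_of t)) -> forall x, P x.
Proof. by move=> h x; rewrite -(cl_of_repr x). Qed.

Lemma cl_addrA : associative cl_add.
Proof.
by elim/cl_ind=> x; elim/cl_ind=> y; elim/cl_ind=> z; rewrite !clE;
  apply/cl_ofP/cl_addA.
Qed.
Lemma cl_addrC : commutative cl_add.
Proof.
by elim/cl_ind=> x; elim/cl_ind=> y; rewrite !clE; apply/cl_ofP/cl_addC.
Qed.
Lemma cl_add0r : left_id cl_zero cl_add.
Proof. by elim/cl_ind=> x; rewrite !clE; apply/cl_ofP/cl_add0. Qed.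
Lemma cl_addNr : left_inverse cl_zero cl_opp cl_add.
Proof. by elim/cl_ind=> x; rewrite !clE; apply/cl_ofP/cl_addN. Qed.

HB.instance Definition _ :=
  GRing.isZmodule.Build clifford cl_addrA cl_addrC cl_add0r cl_addNr.

Lemma cl_mulrA : associative cl_mul.
Proof.
by elim/cl_ind=> x; elim/cl_ind=> y; elim/cl_ind=> z; rewrite !clE;
  apply/cl_ofP/cl_mulA.
Qed.
Lemma cl_mul1r : left_id cl_one cl_mul.
Proof. by elim/cl_ind=> x; rewrite !clE; apply/cl_ofP/cl_mul1L. Qed.
Lemma cl_mulr1 : right_id cl_one cl_mul.
Proof. by elim/cl_ind=> x; rewrite !clE; apply/cl_ofP/cl_mul1R. Qed.
Lemma cl_mulrDl : left_distributive cl_mul cl_add.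
Proof.
by elim/cl_ind=> x; elim/cl_ind=> y; elim/cl_ind=> z; rewrite !clE;
  apply/cl_ofP/cl_mulDl.
Qed.
Lemma cl_mulrDr : right_distributive cl_mul cl_add.
Proof.
by elim/cl_ind=> x; elim/cl_ind=> y; elim/cl_ind=> z; rewrite !clE;
  apply/cl_ofP/cl_mulDr.
Qed.
Lemma cl_one_neq0 : cl_one != cl_zero.
Proof.
have [k [f fP]] := @clifford_model R (r + s) (fun i => - psgn R i).
have fP' Z : f Z * f Z = (- pform Z Z)%:A.
  rewrite fP pformE -sumrN; congr (_%:A).
  by apply: eq_bigr => i _; rewrite mulNr.
apply/eqP => /cl_ofP/(cl_eval_eq fP') /= /eqP.
by rewrite oner_eq0.
Qed.

HB.instance Definition _ := GRing.Zmodule_isNzRing.Build clifford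
  cl_mulrA cl_mul1r cl_mulr1 cl_mulrDl cl_mulrDr cl_one_neq0.

Lemma cl_scalerA a b x : cl_scale a (cl_scale b x) = cl_scale (a * b) x.
Proof. by elim/cl_ind: x => x; rewrite !clE; apply/cl_ofP/cl_scaleA. Qed.
Lemma cl_scale1r : left_id 1 cl_scale.
Proof. by elim/cl_ind => x; rewrite !clE; apply/cl_ofP/cl_scale1. Qed.
Lemma cl_scalerDr : right_distributive cl_scale +%R.
Proof.
move=> a; elim/cl_ind=> x; elim/cl_ind=> y.
rewrite -[LHS]/(cl_scale _ (cl_add _ _)) -[RHS]/(cl_add _ _) !clE.
exact/cl_ofP/cl_scaleDr.
Qed.
Lemma cl_scalerDl x : {morph cl_scale^~ x : a b / a + b}.
Proof.
move=> a b; elim/cl_ind: x => x; rewrite -[RHS]/(cl_add _ _) !clE.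
exact/cl_ofP/cl_scaleDl.
Qed.

HB.instance Definition _ := GRing.Zmodule_isLmodule.Build R clifford
  cl_scalerA cl_scale1r cl_scalerDr cl_scalerDl.

Lemma cl_scalerAl a (x y : clifford) : a *: (x * y) = (a *: x) * y.
Proof.
elim/cl_ind: x => x; elim/cl_ind: y => y.
rewrite -[LHS]/(cl_scale _ (cl_mul _ _)) -[RHS]/(cl_mul (cl_scale _ _) _) !clE.
exact/cl_ofP/cl_scaleAl.
Qed.

HB.instance Definition _ := GRing.Lmodule_isLalgebra.Build R clifford
  cl_scalerAl.

Lemma cl_scalerAr a (x y : clifford) : a *: (x * y) = x * (a *: y).
Proof.
elim/cl_ind: x => x; elim/cl_ind: y => y.
rewrite -[LHS]/(cl_scale _ (cl_mul _ _)) -[RHS]/(cl_mul _ (cl_scale _ _)) !clE.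
exact/cl_ofP/cl_scaleAr.
Qed.

HB.instance Definition _ := GRing.Lalgebra_isAlgebra.Build R clifford
  cl_scalerAr.

Definition cl_vec (Z : 'rV[R]_(r + s)) : clifford := cl_of (CVec Z).

Lemma cl_vec_is_linear : linear cl_vec.
Proof.
move=> a Z W; rewrite -[RHS]/(cl_add (cl_scale _ (cl_of _)) (cl_of _)) !clE.
exact/cl_ofP/cl_vec_linear.
Qed.
HB.instance Definition _ :=
  GRing.isLinear.Build R 'rV[R]_(r + s) clifford _ cl_vec cl_vec_is_linear.

Lemma cl_vec_sqr Z : cl_vec Z * cl_vec Z = (- pform Z Z)%:A.
Proof.
rewrite -[LHS]/(cl_mul (cl_of _) (cl_of _)) -[RHS]/(cl_scale _ (cl_of _)) !clE.
exact/cl_ofP/cl_clifford.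
Qed.

Lemma clifford_universal (A : algType R) (f : {linear 'rV[R]_(r + s) -> A}) :
  (forall Z, f Z * f Z = (- pform Z Z)%:A) ->
  exists2 F : {lrmorphism clifford -> A}, (forall Z, F (cl_vec Z) = f Z) &
    forall G : {lrmorphism clifford -> A},
      (forall Z, G (cl_vec Z) = f Z) -> G =1 F.
Proof.
move=> fP; pose F0 (x : clifford) : A := cl_eval f (repr x).
have F0E t : F0 (cl_of t) = cl_eval f t by apply/(cl_eval_eq fP)/cl_repr_of.
have linF : linear F0.
  move=> a; elim/cl_ind=> x; elim/cl_ind=> y.
  by rewrite -[a *: _ + _]/(cl_add (cl_scale _ _) _) !clE !F0E.
have monF : monoid_morphism F0.
  split; first exact: F0E.
  by elim/cl_ind=> x; elim/cl_ind=> y; rewrite -[_ * _]/(cl_mul _ _) !clE !F0E.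
pose F : {lrmorphism clifford -> A} := HB.pack F0
  (GRing.isLinear.Build _ _ _ _ _ linF)
  (GRing.isMonoidMorphism.Build _ _ _ monF).
exists F => [Z|G GP]; first exact: F0E.
elim/cl_ind => t; rewrite [RHS]F0E; elim: t => /=.
- exact: GP.
- exact: (raddf0 G).
- exact: (rmorph1 G).
- by move=> x <-; rewrite -cl_oppE; apply: (raddfN G).
- by move=> x <- y <-; rewrite -cl_addE; apply: (raddfD G).
- by move=> x <- y <-; rewrite -cl_mulE; apply: (rmorphM G).
- by move=> a x <-; rewrite -cl_scaleE; apply: (linearZZ G).
Qed.

End Clifford.

Record admissible_module (R : realType) (r s : nat) := AdmissibleModule {
  am_space :> vectType R;
  am_rep : {linear clifford R r s -> 'End(am_space)};
  am_form : {symmetric am_space};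
  am_nonzero : (0 < \dim {:am_space})%N;
  am_rep1 : am_rep 1 = \1%VF;
  am_repM : forall a b, am_rep (a * b) = (am_rep a \o am_rep b)%VF;
  am_nondeg : nondegenerate am_form;
  am_skew : forall (Z : 'rV[R]_(r + s)) (v w : am_space),
    am_form (am_rep (cl_vec Z) v) w = - am_form v (am_rep (cl_vec Z) w)
}.

Definition minimal_admissible (R : realType) (r s : nat)
    (M : admissible_module R r s) : Prop :=
  forall M' : admissible_module R r s, (\dim {:M} <= \dim {:M'})%N.

Definition positive_definite (R : realType) (V : vectType R)
    (f : {symmetric V}) : Prop :=
  forall v : V, v != 0 -> 0 < f v v.

Record lie_algebra (R : realType) := LieAlgebra {
  lie_space :> vectType R;
  lie_bracket : {bilinear lie_space -> lie_space -> lie_space};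
  lie_alternating : forall x, lie_bracket x x = 0;
  lie_jacobi : forall x y z,
    lie_bracket x (lie_bracket y z) + lie_bracket y (lie_bracket z x)
    + lie_bracket z (lie_bracket x y) = 0
}.

Section PseudoHType.
Variables (R : realType) (r s : nat) (M : admissible_module R r s).
Local Notation "'z" := 'rV[R]_(r + s) (at level 0).

Definition amJ (Z : 'z) : 'End(M) := am_rep M (cl_vec Z).

(* The coordinates are forced by [vbracketP] with Z in the standard basis. *)
Definition vbracket (v w : M) : 'z :=
  \row_i (psgn R i * am_form M (amJ (delta_mx 0 i) v) w).

Lemma vbracketP (Z : 'z) (v w : M) :
  am_form M (amJ Z v) w = pform Z (vbracket v w).
Proof.
rewrite pformE {1}(row_sum_delta Z) /amJ !linear_sum sum_lfunE linear_sumlz.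
apply: eq_bigr => i _; rewrite !linearZ /= scale_lfunE linearZl_LR /= mxE.
by rewrite mulrCA (mulrA (psgn R i)) psgn_sqr mul1r.
Qed.

Lemma vbracket_unique (b : M -> M -> 'z) :
  (forall Z v w, am_form M (amJ Z v) w = pform Z (b v w)) ->
  forall v w, b v w = vbracket v w.
Proof. by move=> h v w; apply: pform_nondeg => Z; rewrite -h vbracketP. Qed.

Lemma vbracketPl a v1 v2 w :
  vbracket (a *: v1 + v2) w = a *: vbracket v1 w + vbracket v2 w.
Proof.
apply: pform_nondeg => Z; rewrite pformDr pformZr -!vbracketP.
by rewrite linearP linearDl linearZl_LR.
Qed.

Lemma vbracketPr a v w1 w2 :
  vbracket v (a *: w1 + w2) = a *: vbracket v w1 + vbracket v w2.
Proof.
apply: pform_nondeg => Z; rewrite pformDr pformZr -!vbracketP.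
by rewrite linearDr linearZr_LR.
Qed.

Lemma vbracket0l w : vbracket 0 w = 0.
Proof.
by apply: pform_nondeg => Z; rewrite pform0r -vbracketP linear0 linear0l.
Qed.

Lemma vbracket0r v : vbracket v 0 = 0.
Proof. by apply: pform_nondeg => Z; rewrite pform0r -vbracketP linear0r. Qed.

Lemma vbracketvv v : vbracket v v = 0.
Proof.
apply: pform_nondeg => Z; rewrite pform0r -vbracketP.
have h : am_form M (amJ Z v) v = - am_form M (amJ Z v) v.
  by rewrite -[RHS]mul1r [LHS]am_skew [in LHS]hermC expr0 mulrN !mul1r.
by move/eqP: h; rewrite -subr_eq0 opprK -mulr2n mulrn_eq0 => /eqP.
Qed.

Definition pseudoH_space : vectType R := (M * 'z)%type.

Definition pseudoH_bracket (x y : pseudoH_space) : pseudoH_space :=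
  (0, vbracket x.1 y.1).

Lemma pseudoH_bilinear : bilinear_for *:%R *:%R pseudoH_bracket.
Proof.
split=> [y a x1 x2|x a y1 y2]; congr pair => /=.
- by rewrite scaler0 addr0.
- exact: vbracketPl.
- by rewrite scaler0 addr0.
- exact: vbracketPr.
Qed.
HB.instance Definition _ := bilinear_isBilinear.Build R pseudoH_space
  pseudoH_space pseudoH_space *:%R *:%R pseudoH_bracket pseudoH_bilinear.

Lemma pseudoH_alternating x : pseudoH_bracket x x = 0.
Proof. by rewrite /pseudoH_bracket vbracketvv. Qed.

Lemma pseudoH_jacobi x y z :
  pseudoH_bracket x (pseudoH_bracket y z)
  + pseudoH_bracket y (pseudoH_bracket z x)
  + pseudoH_bracket z (pseudoH_bracket x y) = 0.
Proof. by rewrite /pseudoH_bracket /= !vbracket0r !addr0. Qed.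

Definition pseudoH : lie_algebra R := @LieAlgebra R pseudoH_space
  pseudoH_bracket pseudoH_alternating pseudoH_jacobi.

Definition pseudoH_form (x y : pseudoH) : R :=
  am_form M x.1 y.1 + pform x.2 y.2.

Definition in_v (v : M) : pseudoH := (v, 0).
Definition in_z (Z : 'z) : pseudoH := (0, Z).

Lemma pseudoH_bracketP (Z : 'z) (v w : M) :
  pseudoH_form (in_v (amJ Z v)) (in_v w)
  = pseudoH_form (in_z Z) (lie_bracket pseudoH (in_v v) (in_v w)).
Proof. by rewrite /pseudoH_form /= pform0r addr0 linear0r add0r vbracketP. Qed.

Lemma pseudoH_center (x : pseudoH) : (0 < r + s)%N ->
  (forall y, lie_bracket pseudoH x y = 0) <-> exists Z, x = in_z Z.
Proof.
move=> rs; split=> [h|[Z ->] y]; last first.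
  by rewrite /= /pseudoH_bracket /= vbracket0l.
case: x h => v Z h; exists Z; congr pair.
pose i : 'I_(r + s) := Ordinal rs; pose e : 'z := delta_mx 0 i.
have Jv0 : amJ e v = 0.
  apply/eqP; rewrite -memv0 -(eqP (am_nondeg M)).
  apply/mem_orthovP => w _; rewrite vbracketP.
  by have /(congr1 snd) /= -> := h (in_v w); rewrite pform0r.
have : amJ e (amJ e v) = - psgn R i *: v.
  rewrite -comp_lfunE -am_repM cl_vec_sqr pform_delta linearZ /= am_rep1.
  by rewrite scale_lfunE id_lfunE mxE !eqxx mulr1.
rewrite Jv0 linear0 => /esym/eqP; rewrite scaler_eq0 oppr_eq0 => /orP[/eqP p0|].
  by have := psgn_sqr R i; rewrite p0 mul0r => /eqP; rewrite eq_sym oner_eq0.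
by move/eqP.
Qed.

(* Surjectivity of ad_v : M -> R^{r,s}, source and target being seen in the Lie algebra. *)
Definition strongly_bracket_generating : Prop :=
  forall v : M, v != 0 ->
    forall Z : 'z, exists w : M, lie_bracket pseudoH (in_v v) (in_v w) = in_z Z.

End PseudoHType.

(* Main.v *)
Require Import Defs.
From HB Require Import structures.
From mathcomp Require Import all_boot all_order all_algebra.
From mathcomp Require Import reals.

(** The map [ad_v] is, up to the two scalar products, the transpose of the map
    [Z |-> J_Z v]: this is what [<J_Z v, w> = <Z, [v, w]>] says.  Since the form
    on the module is non-degenerate, [ad_v] is therefore surjective as soon as
    [Z |-> J_Z v] is injective ([vbracket_surjective]).  The Clifford relation
    gives [J_Z J_Z v = - <Z, Z> v] ([amJ_sqr]), so that for a non-zero [v] the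
    equation [J_Z v = 0] forces [<Z, Z> = 0].  When [r = 0] or [s = 0] the form
    of [R^{r,s}] is definite, hence has no non-zero isotropic vector
    ([pform_anisotropic]), and injectivity follows. *)

Set Implicit Arguments.
Unset Strict Implicit.
Unset Printing Implicit Defensive.
Import GRing.Theory Num.Theory.
Local Open Scope ring_scope.

(** A non-degenerate form makes [w |-> f(-, w)] injective from a space to its
    dual; both have the same dimension, so every linear form is attained. *)
Lemma nondegenerate_riesz (F : fieldType) (V : vectType F) (f : {symmetric V}) :
  nondegenerate f ->
  forall phi : 'Hom(V, F^o), exists w, forall x, f x w = phi x.
Proof.
move=> nd phi.
pose D w : 'Hom(V, F^o) := linfun (applyr f w : V -> F^o).
have DE w x : D w x = f x w by rewrite lfunE.
have linD : linear D.
  move=> a w1 w2; apply/lfunP => x.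
  by rewrite add_lfunE scale_lfunE !DE linearDr linearZr_LR.
pose Dl : {linear V -> 'Hom(V, F^o)} := HB.pack D
  (GRing.isLinear.Build _ _ _ _ _ linD).
have ker0 : lker (linfun Dl) = 0%VS.
  apply/eqP; rewrite -subv0 -(eqP nd); apply/subvP => w.
  rewrite memv_ker lfunE /= => /eqP Dw0.
  apply/mem_orthovP => x _; rewrite hermC expr0 mul1r /=.
  by rewrite -DE Dw0 lfunE.
have full : limg (linfun Dl) = fullv.
  apply/eqP; rewrite eqEdim subvf limg_dim_eq ?ker0 ?capv0 //.
  rewrite !dimvf -[leqRHS]muln1; exact: leqnn.
have /memv_imgP[w _ phiE] : phi \in limg (linfun Dl) by rewrite full memvf.
by exists w => x; rewrite phiE lfunE /= DE.
Qed.

(** With a single sign in its signature, the form is plus or minus a sum of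
    squares; light-like vectors exist as soon as both signs occur. *)
Lemma pform_anisotropic (R : realType) (r s : nat) (Z : 'rV[R]_(r + s)) :
  r = 0%N \/ s = 0%N -> pform Z Z = 0 -> Z = 0.
Proof.
move=> rs0 ZZ0.
have [e eE] : exists e : R, forall i : 'I_(r + s), psgn R i = e.
  case: rs0 => ?; subst; [exists (-1) | exists 1] => i;
  by rewrite /psgn; case: split => // -[].
have : e * \sum_i Z 0 i ^+ 2 = 0.
  by rewrite -[RHS]ZZ0 pformE mulr_sumr; apply: eq_bigr => i _; rewrite eE expr2.
move=> /eqP sum0; apply/rowP => i; rewrite mxE.
have eN0 : e != 0.
  apply/eqP => e0; have := psgn_sqr R i.
  by rewrite eE e0 mul0r => /eqP; rewrite eq_sym oner_eq0.
move: sum0; rewrite mulf_eq0 (negPf eN0) /= psumr_eq0; last first.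
  by move=> j _; apply: sqr_ge0.
by move=> /allP/(_ i (mem_index_enum _)); rewrite sqrf_eq0 => /eqP.
Qed.

Lemma amJ_sqr (R : realType) (r s : nat) (M : admissible_module R r s)
  (Z : 'rV[R]_(r + s)) (v : M) : amJ M Z (amJ M Z v) = - pform Z Z *: v.
Proof.
by rewrite -comp_lfunE -am_repM cl_vec_sqr linearZ /= am_rep1 scale_lfunE
  id_lfunE.
Qed.

(** An injective linear map has a surjective transpose.  To reach [Z], one
    prescribes the linear form [J_{Z'} v |-> <Z, Z'>] on the image of
    [Z' |-> J_{Z'} v], which injectivity makes well defined, extends it to the
    module, and represents it by a vector [w]. *)
Lemma vbracket_surjective (R : realType) (r s : nat)
    (M : admissible_module R r s) (v : M) :
  (forall Z : 'rV[R]_(r + s), amJ M Z v = 0 -> Z = 0) ->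
  forall Z : 'rV[R]_(r + s), exists w, vbracket v w = Z.
Proof.
move=> injJ Z.
have linj : linear (fun Z => amJ M Z v).
  by move=> a Z1 Z2; rewrite /amJ !linearP add_lfunE scale_lfunE.
pose j : {linear 'rV[R]_(r + s) -> M} := HB.pack (fun Z => amJ M Z v)
  (GRing.isLinear.Build _ _ _ _ _ linj).
pose h := linfun j.
have hK : cancel h (h^-1)%VF.
  apply: lker0_lfunK; rewrite -subv0; apply/subvP => Z'.
  by rewrite memv_ker lfunE memv0 => /eqP/injJ ->.
have linp : linear (pform Z : _ -> R^o).
  by move=> a W1 W2; rewrite pformDr pformZr.
pose p : {linear 'rV[R]_(r + s) -> R^o} := HB.pack (pform Z : _ -> R^o)
  (GRing.isLinear.Build _ _ _ _ _ linp).
(* The inverse of [h] is total, so composing with it also chooses an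
   extension of the linear form from the image of [h] to the module. *)
have [w wE] := nondegenerate_riesz (am_nondeg M) (linfun p \o h^-1)%VF.
exists w; apply: pform_nondeg => Z'; rewrite -vbracketP.
have -> : amJ M Z' v = h Z' by rewrite lfunE.
by rewrite wE comp_lfunE hK lfunE /= pform_sym.
Qed.

Theorem theorem7p5 (R : realType) (r s : nat) (hrs : (1 <= r + s)%N)
  (M : admissible_module R r s) (hmin : minimal_admissible M)
  (hpos : s = 0%N -> positive_definite (am_form M))
  (hrs0 : r = 0%N \/ s = 0%N) :
  strongly_bracket_generating M.
Proof.
move=> v vN0 Z.
have injJ Z' : amJ M Z' v = 0 -> Z' = 0.
  move=> Jv0; apply: (pform_anisotropic hrs0).
  have /esym/eqP := amJ_sqr Z' v.
  by rewrite Jv0 linear0 scaler_eq0 (negPf vN0) orbF oppr_eq0 => /eqP.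
have [w wZ] := vbracket_surjective injJ Z.
by exists w; congr pair.
Qed.
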